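(* Suppose $(\Gamma_1\vdash M_1)\equiv_\alpha(\Gamma_2\vdash M_2)$, $\Gamma_1\vdash M_1\overset{\lambda\pi}{\rightsquigarrow\rightsquigarrow}\Delta_1\vdash N_1$ and $\Gamma_2\vdash M_2\overset{\lambda\pi}{\rightsquigarrow\rightsquigarrow}\Delta_2\vdash N_2$; then there are $\Sigma_1\vdash L_1$ and $\Sigma_2\vdash L_2$ such that $\Delta_1\vdash N_1\overset{\lambda\pi}{\rightsquigarrow\rightsquigarrow}\Sigma_1\vdash L_1$, $\Delta_2\vdash N_2\overset{\lambda\pi}{\rightsquigarrow\rightsquigarrow}\Sigma_2\vdash L_2$, and $(\Sigma_1\vdash L_1)\equiv_\alpha(\Sigma_2\vdash L_2)$.
   Context: $\lambda\pi$: terms $M::= a\mid MN\mid\lambda a.M\mid s\circ M$, substitutions $s::= id\mid\pi_a\mid\langle s\,,\,N\backslash a\rangle\mid s\circ q$; judgements $\Gamma\vdash M$ with $\Gamma$ a list of variables (repetitions allowed). Reduction: (Beta) $(\lambda a.M)N\rightarrow\langle id\,,\,N\backslash a\rangle\circ M$ plus the explicit-substitution rules Abs, App, ConsVar, New, IdVar, Clos, Ass, IdR, IdShift, ConsShift, Map, $\pi_1$, $\pi_2$, the bound-variable renaming $\alpha_1$: $\lambda a.M\rightarrow\lambda b.\langle\pi_b\,,\,b\backslash a\rangle\circ M$, and the context-variable renaming $\alpha_2$ on judgements; $\rightsquigarrow\rightsquigarrow$ is the reflexive-transitive reduction on judgements. $\alpha$-equivalence: extended name-free terms $U::=\underline n\mid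 UV\mid\lambda U\mid u\circ U$, $u::=id\mid\pi\mid\langle u\,,\,V\rangle\mid u\circ v$; translation $(\Gamma,a\vdash a)\Rightarrow(|\Gamma,a|\vdash\underline1)$; $(\Gamma\vdash a)\Rightarrow(|\Gamma|\vdash\underline n)$ gives $(\Gamma,b\vdash a)\Rightarrow(|\Gamma,b|\vdash\underline{n+1})$ ($a\neq b$); compositional on application, $\lambda a.M\mapsto\lambda U$, $s\circ M\mapsto u\circ U$, $id\mapsto id$, $\pi_a\mapsto\pi$, $\langle s\,,\,N\backslash a\rangle\mapsto\langle u\,,\,V\rangle$, $s\circ q\mapsto u\circ v$; $(\Gamma\vdash M)\equiv_\alpha(\Delta\vdash N)$ iff both translate to the same name-free judgement $m\vdash U$. *)

(* Defs.v *)
From Stdlib Require Export List Arith Relations.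
Export ListNotations.

Definition var := nat.

Inductive tm : Type :=
| Var (a : var)                        (* a *)
| App (M N : tm)                       (* M N *)
| Lam (a : var) (M : tm)               (* λa.M *)
| Clo (s : sb) (M : tm)                (* s ∘ M *)
with sb : Type :=
| Id                                   (* id *)
| Pi (a : var)                         (* π_a *)
| Cons (s : sb) (N : tm) (a : var)     (* ⟨s , N\a⟩ *)
| Comp (s q : sb).                     (* s ∘ q *)

(* Contexts grow at the head: "Γ, a" is [a :: G], and "Γ, a, Δ" is
   [D ++ a :: G].  Repetitions are allowed; a variable refers to its rightmost
   (nearest the head) occurrence, and the earlier ones are reached through [Pi]. *)
Definition ctx := list var.

Definition judgement : Type := ctx * tm.

(* s ∘ q applies q first: a substitution Γ ⊢ s ▷ Δ turns a term over Δ into a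
   term over Γ.  If Γ ⊢ s ▷ Δ then Γ,a ⊢ lift a s ▷ Δ,a. *)
Definition lift (a : var) (s : sb) : sb := Cons (Comp (Pi a) s) (Var a) a.

(* Γ,b ⊢ rename b a ▷ Γ,a *)
Definition rename (b a : var) : sb := Cons (Pi b) (Var b) a.

(* Γ,b,Δ ⊢ lifts Δ (rename b a) ▷ Γ,a,Δ *)
Definition lifts (D : ctx) (s : sb) : sb := fold_right lift s D.

Inductive rule_tm : tm -> tm -> Prop :=
| R_Beta a M N :
    rule_tm (App (Lam a M) N) (Clo (Cons Id N a) M)
| R_Abs s a M :
    rule_tm (Clo s (Lam a M)) (Lam a (Clo (lift a s) M))
| R_App s M N :
    rule_tm (Clo s (App M N)) (App (Clo s M) (Clo s N))
| R_ConsVar s N a :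
    rule_tm (Clo (Cons s N a) (Var a)) N
| R_New s N a b :
    a <> b -> rule_tm (Clo (Cons s N a) (Var b)) (Clo s (Var b))
| R_IdVar a :
    rule_tm (Clo Id (Var a)) (Var a)
| R_Clos s q M :
    rule_tm (Clo s (Clo q M)) (Clo (Comp s q) M)
| R_pi1 a b :
    a <> b -> rule_tm (Clo (Pi b) (Var a)) (Var a)
| R_pi2 s a b :
    a <> b -> rule_tm (Clo (Comp s (Pi b)) (Var a)) (Clo s (Var a))
| R_alpha1 a b M :
    rule_tm (Lam a M) (Lam b (Clo (rename b a) M)).

Inductive rule_sb : sb -> sb -> Prop :=
| R_Ass s q r :
    rule_sb (Comp s (Comp q r)) (Comp (Comp s q) r)
| R_IdR s :
    rule_sb (Comp s Id) s
| R_IdShift a :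
    rule_sb (Comp Id (Pi a)) (Pi a)
| R_ConsShift s N a :
    rule_sb (Comp (Cons s N a) (Pi a)) s
| R_Map s q N a :
    rule_sb (Comp s (Cons q N a)) (Cons (Comp s q) (Clo s N) a).

Inductive step_tm : tm -> tm -> Prop :=
| S_rule_tm M N : rule_tm M N -> step_tm M N
| S_AppL M M' N : step_tm M M' -> step_tm (App M N) (App M' N)
| S_AppR M N N' : step_tm N N' -> step_tm (App M N) (App M N')
| S_Lam a M M' : step_tm M M' -> step_tm (Lam a M) (Lam a M')
| S_CloL s s' M : step_sb s s' -> step_tm (Clo s M) (Clo s' M)
| S_CloR s M M' : step_tm M M' -> step_tm (Clo s M) (Clo s M')
with step_sb : sb -> sb -> Prop :=
| S_rule_sb s q : rule_sb s q -> step_sb s q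
| S_ConsL s s' N a : step_sb s s' -> step_sb (Cons s N a) (Cons s' N a)
| S_ConsR s N N' a : step_tm N N' -> step_sb (Cons s N a) (Cons s N' a)
| S_CompL s s' q : step_sb s s' -> step_sb (Comp s q) (Comp s' q)
| S_CompR s q q' : step_sb q q' -> step_sb (Comp s q) (Comp s q').

(* α₂ renames a context variable at any position.  Renaming only the last one
   would break confluence modulo α: a,a,b ⊢ π_b ∘ (π_a ∘ a) is α-equivalent to
   c,d,b ⊢ π_b ∘ (π_d ∘ c), which reduces to c,d,b ⊢ c, and no term over a
   context a,a,e translates to the index 3. *)
Inductive step : judgement -> judgement -> Prop :=
| J_tm G M N : step_tm M N -> step (G, M) (G, N)
| J_alpha2 G D a b M :
    step (D ++ a :: G, M) (D ++ b :: G, Clo (lifts D (rename b a)) M).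

Definition red : judgement -> judgement -> Prop := clos_refl_trans judgement step.

(* Extended name-free terms.  Indices start at 1; [NVar 0] is never the
   translation of anything. *)
Inductive ntm : Type :=
| NVar (n : nat)
| NApp (U V : ntm)
| NLam (U : ntm)
| NClo (u : nsb) (U : ntm)
with nsb : Type :=
| NId
| NPi
| NCons (u : nsb) (V : ntm)
| NComp (u v : nsb).

Definition njudgement : Type := nat * ntm.

(* [trans_tm G M U] : (Γ ⊢ M) ⇒ (|Γ| ⊢ U);
   [trans_sb G s D u] : (Γ ⊢ s ▷ Δ) ⇒ (|Γ| ⊢ u ▷ |Δ|).
   Only well-scoped judgements translate. *)
Inductive trans_tm : ctx -> tm -> ntm -> Prop :=
| T_Var1 G a : trans_tm (a :: G) (Var a) (NVar 1)
| T_VarS G a b n :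
    a <> b -> trans_tm G (Var a) (NVar n) ->
    trans_tm (b :: G) (Var a) (NVar (S n))
| T_App G M N U V :
    trans_tm G M U -> trans_tm G N V -> trans_tm G (App M N) (NApp U V)
| T_Lam G a M U :
    trans_tm (a :: G) M U -> trans_tm G (Lam a M) (NLam U)
| T_Clo G D s M u U :
    trans_sb G s D u -> trans_tm D M U -> trans_tm G (Clo s M) (NClo u U)
with trans_sb : ctx -> sb -> ctx -> nsb -> Prop :=
| T_Id G : trans_sb G Id G NId
| T_Pi G a : trans_sb (a :: G) (Pi a) G NPi
| T_Cons G D s N a u V :
    trans_sb G s D u -> trans_tm G N V ->
    trans_sb G (Cons s N a) (a :: D) (NCons u V)
| T_Comp G D E s q u v :
    trans_sb G s D u -> trans_sb D q E v ->
    trans_sb G (Comp s q) E (NComp u v).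

Inductive trans : judgement -> njudgement -> Prop :=
| Trans G M U : trans_tm G M U -> trans (G, M) (length G, U).

Definition alpha_equiv (J1 J2 : judgement) : Prop :=
  exists K : njudgement, trans J1 K /\ trans J2 K.

(* Main.v *)
(** The substitution rules and both renamings preserve, and (Beta) reduces, the
    pure de Bruijn term denoted by a judgement; so confluence of parallel
    beta-reduction gives a common reduct of the denotations.  Conversely every
    judgement reduces to the canonical named form of its denotation, in which
    each variable, bound or in the context, is named by its de Bruijn level.
    Such contexts have no repetitions, so no rule is blocked by a clash of
    names, and the canonical forms in turn simulate parallel reduction. *)

Require Import Defs.
From Stdlib Require Import Lia.

Scheme trans_tm_mind := Induction for trans_tm Sort Prop
  with trans_sb_mind := Induction for trans_sb Sort Prop.
Combined Scheme trans_mutind from trans_tm_mind, trans_sb_mind.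

Scheme step_tm_mind := Induction for step_tm Sort Prop
  with step_sb_mind := Induction for step_sb Sort Prop.
Combined Scheme step_mutind from step_tm_mind, step_sb_mind.

Create HintDb lp.

(** * Pure de Bruijn terms *)

Inductive db : Type :=
| DVar (i : nat)
| DApp (t u : db)
| DLam (t : db).

Definition scons {A : Type} (x : A) (f : nat -> A) (i : nat) : A :=
  match i with 0 => x | S j => f j end.

Fixpoint ren (r : nat -> nat) (t : db) : db :=
  match t with
  | DVar i => DVar (r i)
  | DApp t u => DApp (ren r t) (ren r u)
  | DLam t => DLam (ren (scons 0 (fun i => S (r i))) t)
  end.

Definition up (f : nat -> db) : nat -> db :=
  scons (DVar 0) (fun i => ren S (f i)).

Fixpoint subst (f : nat -> db) (t : db) : db :=
  match t with
  | DVar i => f i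
  | DApp t u => DApp (subst f t) (subst f u)
  | DLam t => DLam (subst (up f) t)
  end.

Fixpoint closed (n : nat) (t : db) : Prop :=
  match t with
  | DVar i => i < n
  | DApp t u => closed n t /\ closed n u
  | DLam t => closed (S n) t
  end.

Lemma subst_ext t : forall f g, (forall i, f i = g i) -> subst f t = subst g t.
Proof.
  induction t; simpl; intros f g H; auto.
  - f_equal; auto.
  - f_equal; apply IHt; intros [|i]; simpl; [|rewrite H]; auto.
Qed.

(** Renaming is a separate recursion only because [up] needs it before substitution exists; this
    lemma lets facts about substitution serve for shifts too. *)
Lemma ren_as_subst t : forall r, ren r t = subst (fun i => DVar (r i)) t.
Proof.
  induction t; simpl; intros r; auto.
  - f_equal; auto.
  - f_equal; rewrite IHt; apply subst_ext; intros [|i]; reflexivity.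
Qed.

Lemma subst_id t : forall f, (forall i, f i = DVar i) -> subst f t = t.
Proof.
  induction t; simpl; intros f H; auto.
  - f_equal; auto.
  - f_equal; apply IHt; intros [|i]; simpl; [|rewrite H]; reflexivity.
Qed.

Lemma subst_ren t : forall r f, subst f (ren r t) = subst (fun i => f (r i)) t.
Proof.
  induction t; simpl; intros r f; auto.
  - f_equal; auto.
  - f_equal; rewrite IHt; apply subst_ext; intros [|i]; reflexivity.
Qed.

Lemma ren_subst t : forall r f, ren r (subst f t) = subst (fun i => ren r (f i)) t.
Proof.
  induction t; simpl; intros r f; auto.
  - f_equal; auto.
  - f_equal; rewrite IHt; apply subst_ext; intros [|i]; simpl; auto.
    rewrite (ren_as_subst (ren S (f i))), (ren_as_subst (ren r (f i))), !subst_ren.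
    reflexivity.
Qed.

Lemma subst_subst t :
  forall f g, subst f (subst g t) = subst (fun i => subst f (g i)) t.
Proof.
  induction t; simpl; intros f g; auto.
  - f_equal; auto.
  - f_equal; rewrite IHt; apply subst_ext; intros [|i]; simpl; auto.
    rewrite subst_ren, ren_subst. reflexivity.
Qed.

Lemma closed_ren t : forall m n r,
  (forall i, i < m -> r i < n) -> closed m t -> closed n (ren r t).
Proof.
  induction t; simpl; intros m n r H C; auto.
  - destruct C; eauto.
  - eapply IHt; [|exact C].
    intros [|i] Hi; simpl; [lia|]. apply -> Nat.succ_lt_mono. apply H. lia.
Qed.

Lemma closed_shift n t : closed n t -> closed (S n) (ren S t).
Proof. apply closed_ren. lia. Qed.

Lemma closed_subst t : forall m n f,
  (forall i, i < m -> closed n (f i)) -> closed m t -> closed n (subst f t).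
Proof.
  induction t; simpl; intros m n f H C; auto.
  - destruct C; eauto.
  - eapply IHt; [|exact C].
    intros [|i] Hi; simpl; [lia|]. apply closed_shift. apply H. lia.
Qed.

(** * Parallel reduction *)

Inductive par : db -> db -> Prop :=
| par_var i : par (DVar i) (DVar i)
| par_app t t' u u' : par t t' -> par u u' -> par (DApp t u) (DApp t' u')
| par_lam t t' : par t t' -> par (DLam t) (DLam t')
| par_beta t t' u u' :
    par t t' -> par u u' ->
    par (DApp (DLam t) u) (subst (scons u' DVar) t').
#[local] Hint Constructors par : lp.

Lemma par_refl t : par t t.
Proof. induction t; auto with lp. Qed.
#[local] Hint Resolve par_refl : lp.

Lemma par_beta_eq t t' u u' w :
  par t t' -> par u u' -> w = subst (scons u' DVar) t' ->
  par (DApp (DLam t) u) w.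
Proof. intros ? ? ->. auto with lp. Qed.

Lemma par_ren t t' : par t t' -> forall r, par (ren r t) (ren r t').
Proof.
  induction 1; simpl; intros r; auto with lp.
  eapply par_beta_eq; eauto.
  rewrite ren_subst, subst_ren. apply subst_ext. intros [|i]; reflexivity.
Qed.

Lemma par_up f g : (forall i, par (f i) (g i)) -> forall i, par (up f i) (up g i).
Proof. intros H [|i]; simpl; auto using par_ren with lp. Qed.

Lemma par_subst t t' : par t t' ->
  forall f g, (forall i, par (f i) (g i)) -> par (subst f t) (subst g t').
Proof.
  induction 1; simpl; intros f g H'; auto using par_up with lp.
  eapply par_beta_eq; [apply IHpar1, par_up, H' | apply IHpar2, H' |].
  rewrite !subst_subst. apply subst_ext. intros [|i]; simpl; auto.
  rewrite subst_ren. symmetry. apply subst_id. reflexivity.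
Qed.

(** Takahashi's complete development: all redexes present in the term are contracted at once. *)
Fixpoint dev (t : db) : db :=
  match t with
  | DVar i => DVar i
  | DApp (DLam t) u => subst (scons (dev u) DVar) (dev t)
  | DApp t u => DApp (dev t) (dev u)
  | DLam t => DLam (dev t)
  end.

Lemma par_dev t u : par t u -> par u (dev t).
Proof.
  induction 1 as [| t t' u u' Ht IHt Hu IHu | | t t' u u' Ht IHt Hu IHu];
    simpl; auto with lp.
  (* If [t] is an abstraction, so is its reduct; the redex left uncontracted is then contracted by
     [par_beta] to catch up with [dev]. *)
  - destruct t; auto with lp.
    inversion Ht; subst. inversion IHt; subst. auto with lp.
  - apply par_subst; auto. intros [|i]; simpl; auto with lp.
Qed.

Lemma closed_par t u : par t u -> forall n, closed n t -> closed n u.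
Proof.
  induction 1; simpl; intros n C; auto.
  - destruct C; auto.
  - destruct C. eapply closed_subst; [|apply IHpar1; eassumption].
    intros [|i] Hi; simpl; [auto|lia].
Qed.

(** * Confluence of parallel reduction *)

Notation pars := (clos_refl_trans db par).

Lemma pars_strip t u v :
  pars t u -> par t v -> exists w, par u w /\ pars v w.
Proof.
  intros H. apply clos_rt_rt1n in H. revert v.
  induction H as [t | t t' u H H' IH]; intros v Hv.
  - exists v. split; [assumption | apply rt_refl].
  (* [dev t] is a parallel reduct of both [t'] and [v], so it closes the first square and the rest
     of the chain is stripped from there. *)
  - destruct (IH (dev t)) as (w & Hw1 & Hw2); [apply par_dev, H|].
    exists w. split; auto.
    eapply rt_trans; [apply rt_step, par_dev, Hv | exact Hw2].
Qed.

Lemma pars_confluent t u v :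
  pars t u -> pars t v -> exists w, pars u w /\ pars v w.
Proof.
  intros Hu Hv. apply clos_rt_rt1n in Hv. revert u Hu.
  induction Hv as [t | t t' v H H' IH]; intros u Hu.
  - exists u. split; [apply rt_refl | assumption].
  - destruct (pars_strip t u t' Hu H) as (w & Hw1 & Hw2).
    destruct (IH w Hw2) as (x & Hx1 & Hx2).
    exists x. split; auto. eapply rt_trans; [apply rt_step, Hw1 | exact Hx1].
Qed.

(** * Denotations and subject reduction *)

(** Name-free indices start at 1 and those of [db] at 0, hence [pred]. A substitution denotes a
    total function on indices, and a composition applies its right component first. *)
Fixpoint den (U : ntm) : db :=
  match U with
  | NVar n => DVar (pred n)
  | NApp U V => DApp (den U) (den V)
  | NLam U => DLam (den U)
  | NClo u U => subst (dens u) (den U)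
  end
with dens (u : nsb) : nat -> db :=
  match u with
  | NId => DVar
  | NPi => fun i => DVar (S i)
  | NCons u V => scons (den V) (dens u)
  | NComp u v => fun i => subst (dens u) (dens v i)
  end.

Lemma trans_var G a U :
  trans_tm G (Var a) U -> exists i, U = NVar (S i) /\ i < length G.
Proof.
  remember (Var a) as M eqn:E. intros H; revert E.
  induction H; intros E; inversion E; subst; simpl.
  - exists 0. split; [auto|lia].
  - destruct IHtrans_tm as (i & Hi & ?); auto. inversion Hi; subst.
    exists (S i). split; [auto|lia].
Qed.

Lemma closed_den_mut :
  (forall G M U, trans_tm G M U -> closed (length G) (den U)) /\
  (forall G s D u, trans_sb G s D u ->
    forall i, i < length D -> closed (length G) (dens u i)).
Proof.
  apply trans_mutind; simpl; intros; auto.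
  - lia.
  - destruct (trans_var _ _ _ t) as (i & Hi & ?). inversion Hi; subst. lia.
  - eapply closed_subst; eauto.
  - lia.
  - destruct i; simpl; auto. apply H; lia.
  - eapply closed_subst; eauto.
Qed.

Definition closed_den := proj1 closed_den_mut.
Definition closed_dens := proj2 closed_den_mut.

Ltac inv_trans :=
  repeat match goal with
  | H : trans_tm _ (App _ _) _ |- _ => inversion H; clear H; subst
  | H : trans_tm _ (Lam _ _) _ |- _ => inversion H; clear H; subst
  | H : trans_tm _ (Clo _ _) _ |- _ => inversion H; clear H; subst
  | H : trans_sb _ Id _ _ |- _ => inversion H; clear H; subst
  | H : trans_sb _ (Pi _) _ _ |- _ => inversion H; clear H; subst
  | H : trans_sb _ (Cons _ _ _) _ _ |- _ => inversion H; clear H; subst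
  | H : trans_sb _ (Comp _ _) _ _ |- _ => inversion H; clear H; subst
  end.

#[local] Hint Constructors trans_tm trans_sb : lp.

(** Only (Beta) yields a genuine parallel step; for every other rule the two denotations are equal,
    and reflexivity of [par] covers them. *)
Lemma rule_tm_den M N : rule_tm M N -> forall G U, trans_tm G M U ->
  exists V, trans_tm G N V /\ par (den U) (den V).
Proof.
  intros H; destruct H; intros G U T; inv_trans;
    try match goal with
    | H : trans_tm (_ :: _) (Var _) _ |- _ => inversion H; subst; try congruence
    end;
    (* The index of a translated variable is a successor, so that [pred] and [scons] compute on
       it. *)
    try match goal with
    | H : trans_tm ?D (Var ?a) ?U, _ : trans_sb _ _ (_ :: ?D) _ |- _ =>
        destruct (trans_var _ _ _ H) as (i & Hi & ?); inversion Hi; subst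
    | H : trans_tm ?D (Var ?a) ?U |- _ =>
        destruct (trans_var _ _ _ H) as (i & Hi & ?); inversion Hi; subst
    end;
    (eexists; split; [unfold lift, rename; eauto 8 with lp|]; simpl; auto with lp).
  (* What remains is Abs, where [lift] denotes [up]; Clos, the composition law; and the bound
     renaming, which denotes the identity. *)
  - erewrite subst_ext; [apply par_refl|].
    intros [|i]; simpl; auto. apply ren_as_subst.
  - rewrite subst_subst. auto with lp.
  - rewrite subst_id; auto with lp. intros [|i]; reflexivity.
Qed.

Lemma rule_sb_den s q : rule_sb s q -> forall G D u, trans_sb G s D u ->
  exists v, trans_sb G q D v /\ forall i, par (dens u i) (dens v i).
Proof.
  intros H; destruct H; intros G D u T; inv_trans;
    (eexists; split; [eauto with lp|]; simpl; intros i; auto with lp).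
  - rewrite subst_subst. auto with lp.
  - destruct i; simpl; auto with lp.
Qed.

Lemma step_den_mut :
  (forall M N, step_tm M N -> forall G U, trans_tm G M U ->
    exists V, trans_tm G N V /\ par (den U) (den V)) /\
  (forall s q, step_sb s q -> forall G D u, trans_sb G s D u ->
    exists v, trans_sb G q D v /\ forall i, par (dens u i) (dens v i)).
Proof.
  apply step_mutind; intros; eauto using rule_tm_den, rule_sb_den; inv_trans;
    match goal with
    | IH : forall G U, trans_tm G ?M U -> _, T : trans_tm _ ?M _ |- _ =>
        destruct (IH _ _ T) as (? & ? & ?)
    | IH : forall G D u, trans_sb G ?s D u -> _, T : trans_sb _ ?s _ _ |- _ =>
        destruct (IH _ _ _ T) as (? & ? & ?)
    end;
    (eexists; split; [eauto with lp|]; simpl; intros;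
     auto using par_subst with lp).
  - destruct i; simpl; auto with lp.
  - destruct i; simpl; auto with lp.
Qed.

(** Changing a name leaves every index in place, so the context renaming preserves denotations. *)
Lemma lifts_rename_den G D a b :
  exists u, trans_sb (D ++ b :: G) (lifts D (rename b a)) (D ++ a :: G) u /\
    forall i, dens u i = DVar i.
Proof.
  induction D as [|c D (u & Hu & E)]; simpl.
  - eexists; split; [unfold rename; eauto with lp|]. intros [|i]; reflexivity.
  - eexists; split; [unfold lift; eauto with lp|].
    intros [|i]; simpl; [|rewrite E]; reflexivity.
Qed.

Lemma step_den G M D N U : step (G, M) (D, N) -> trans_tm G M U ->
  length D = length G /\ exists V, trans_tm D N V /\ par (den U) (den V).
Proof.
  intros H T. inversion H; subst.
  - split; auto. eapply (proj1 step_den_mut); eauto.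
  - split; [rewrite !length_app; reflexivity|].
    destruct (lifts_rename_den G0 D0 a b) as (u & Hu & E).
    eexists; split; [eauto with lp|]. simpl.
    rewrite subst_id; auto with lp.
Qed.

Lemma red_den G M D N U : red (G, M) (D, N) -> trans_tm G M U ->
  length D = length G /\ exists V, trans_tm D N V /\ pars (den U) (den V).
Proof.
  intros H. apply clos_rt_rt1n in H.
  remember (G, M) as J eqn:EJ. remember (D, N) as K eqn:EK.
  revert G M U EJ. induction H as [J | J [G' M'] K H _ IH]; intros G M U -> T.
  - inversion EK; subst. split; auto. exists U. split; [auto | apply rt_refl].
  - destruct (step_den _ _ _ _ _ H T) as (El & V & TV & HV).
    destruct (IH EK _ _ _ eq_refl TV) as (El' & W & TW & HW).
    split; [congruence|]. exists W. split; auto.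
    eapply rt_trans; [apply rt_step, HV | exact HW].
Qed.

(** * Canonical forms *)

Fixpoint levels (n : nat) : ctx :=
  match n with 0 => [] | S m => m :: levels m end.

(** With [n] variables in scope, index [i] has level [n - S i], and a new binder takes the fresh
    level [n]. Truncated subtraction makes this faithful only on terms closed at [n]. *)
Fixpoint can (n : nat) (t : db) : tm :=
  match t with
  | DVar i => Var (n - S i)
  | DApp t u => App (can n t) (can n u)
  | DLam t => Lam n (can (S n) t)
  end.

Fixpoint nf_of_db (t : db) : ntm :=
  match t with
  | DVar i => NVar (S i)
  | DApp t u => NApp (nf_of_db t) (nf_of_db u)
  | DLam t => NLam (nf_of_db t)
  end.

Lemma den_nf_of_db t : den (nf_of_db t) = t.
Proof. induction t; simpl; congruence. Qed.

Lemma length_levels n : length (levels n) = n.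
Proof. induction n; simpl; auto. Qed.

Lemma trans_can t : forall n, closed n t -> trans_tm (levels n) (can n t) (nf_of_db t).
Proof.
  induction t; simpl; intros n C.
  - revert i C. induction n; intros i C; [lia|]. destruct i; simpl.
    + rewrite Nat.sub_0_r. constructor.
    + constructor; [lia | apply IHn; lia].
  - destruct C; auto with lp.
  - constructor. apply (IHt (S n)), C.
Qed.

Lemma trans_levels_var n a U : trans_tm (levels n) (Var a) U ->
  exists i, U = NVar (S i) /\ i < n /\ a = n - S i.
Proof.
  revert U. induction n; simpl; intros U H; inversion H; subst.
  - exists 0. repeat split; lia.
  - match goal with T : trans_tm (levels n) _ _ |- _ => rename T into T' end.
    destruct (IHn _ T') as (i & Hi & ? & ?). inversion Hi; subst.
    exists (S i). repeat split; lia.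
Qed.

(** * Compatibility of many-step reduction with the constructors *)

Notation tred := (clos_refl_trans tm step_tm).
Notation sred := (clos_refl_trans sb step_sb).

Lemma rt_map {A B : Type} (R : relation A) (Q : relation B) (f : A -> B) :
  (forall x y, R x y -> Q (f x) (f y)) ->
  forall x y, clos_refl_trans A R x y -> clos_refl_trans B Q (f x) (f y).
Proof.
  intros H x y. induction 1; [apply rt_step; auto | apply rt_refl |].
  eapply rt_trans; eauto.
Qed.

Lemma tred_app M M' N N' : tred M M' -> tred N N' -> tred (App M N) (App M' N').
Proof.
  intros HM HN. eapply rt_trans.
  - apply (rt_map step_tm step_tm (fun M => App M N)); [|exact HM].
    intros; apply S_AppL; auto.
  - apply (rt_map step_tm step_tm (App M')); [|exact HN]. apply S_AppR.
Qed.

Lemma tred_lam a M M' : tred M M' -> tred (Lam a M) (Lam a M').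
Proof. apply rt_map, S_Lam. Qed.

Lemma tred_clo s s' M M' : sred s s' -> tred M M' -> tred (Clo s M) (Clo s' M').
Proof.
  intros Hs HM. eapply rt_trans.
  - apply (rt_map step_sb step_tm (fun s => Clo s M)); [|exact Hs].
    intros; apply S_CloL; auto.
  - apply (rt_map step_tm step_tm (Clo s')); [|exact HM]. apply S_CloR.
Qed.

Lemma sred_cons s s' N N' a :
  sred s s' -> tred N N' -> sred (Cons s N a) (Cons s' N' a).
Proof.
  intros Hs HN. eapply rt_trans.
  - apply (rt_map step_sb step_sb (fun s => Cons s N a)); [|exact Hs].
    intros; apply S_ConsL; auto.
  - apply (rt_map step_tm step_sb (fun N => Cons s' N a)); [|exact HN].
    intros; apply S_ConsR; auto.
Qed.

Lemma sred_comp s s' q q' : sred s s' -> sred q q' -> sred (Comp s q) (Comp s' q').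
Proof.
  intros Hs Hq. eapply rt_trans.
  - apply (rt_map step_sb step_sb (fun s => Comp s q)); [|exact Hs].
    intros; apply S_CompL; auto.
  - apply (rt_map step_sb step_sb (Comp s')); [|exact Hq]. apply S_CompR.
Qed.

Lemma tred_rule M N P : rule_tm M N -> tred N P -> tred M P.
Proof. intros H. apply rt_trans, rt_step, S_rule_tm, H. Qed.

Lemma sred_rule s q r : rule_sb s q -> sred q r -> sred s r.
Proof. intros H. apply rt_trans, rt_step, S_rule_sb, H. Qed.

(** * Normal substitutions and weakening *)

(* levels (k + m) ⊢ pis k m ▷ levels m *)
Fixpoint pis (k m : nat) : sb :=
  match k with
  | 0 => Id
  | S k' => match k' with 0 => Pi m | S _ => Comp (pis k' (S m)) (Pi m) end
  end.

(* levels n ⊢ s ▷ D is a normal substitution denoting f, whose explicit entries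
   satisfy P.  Normalization is run first with entries that are variables,
   which gives weakening of canonical terms, and then with arbitrary ones. *)
Inductive nsub (P : db -> Prop) : nat -> sb -> ctx -> (nat -> db) -> Prop :=
| nsub_pis k m f :
    (forall i, i < m -> f i = DVar (k + i)) ->
    nsub P (k + m) (pis k m) (levels m) f
| nsub_cons n s D f a :
    nsub P n s D (fun i => f (S i)) -> P (f 0) -> closed n (f 0) ->
    nsub P n (Cons s (can n (f 0)) a) (a :: D) f.

Lemma nsub_ext P n s D f g :
  nsub P n s D f -> (forall i, f i = g i) -> nsub P n s D g.
Proof.
  intros H; revert g.
  induction H as [k m f Hf | n s D f a H IH HP HC]; intros g E.
  - constructor. intros. rewrite <- E. auto.
  - rewrite E in *. constructor; auto.
Qed.

Lemma nsub_cons_eq P n s D f a t M :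
  nsub P n s D f -> P t -> closed n t -> M = can n t ->
  nsub P n (Cons s M a) (a :: D) (scons t f).
Proof.
  intros H HP HC ->. exact (nsub_cons P n s D (scons t f) a H HP HC).
Qed.

Lemma nsub_id P n f : (forall i, f i = DVar i) -> nsub P n Id (levels n) f.
Proof. intros E. apply (nsub_pis P 0 n). auto. Qed.

Lemma nsub_pi P n f : (forall i, f i = DVar (S i)) -> nsub P (S n) (Pi n) (levels n) f.
Proof. intros E. apply (nsub_pis P 1 n). auto. Qed.

Lemma nsub_closed P n s D f :
  nsub P n s D f -> forall i, i < length D -> closed n (f i).
Proof.
  induction 1; simpl.
  - intros i Hi. rewrite length_levels in Hi. rewrite H by auto. simpl. lia.
  - intros [|i] Hi; auto. apply IHnsub. lia.
Qed.

(** All projections in [pis k m] carry names at least [m], hence different from [a], so the side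
    conditions of the projection rules hold. *)
Lemma pis_var k : forall m a, a < m -> tred (Clo (pis k m) (Var a)) (Var a).
Proof.
  induction k as [|[|k] IH]; intros m a Ha.
  - eapply tred_rule; [constructor | apply rt_refl].
  - eapply tred_rule; [constructor; lia | apply rt_refl].
  - eapply tred_rule; [apply R_pi2; lia | apply IH; lia].
Qed.

(** The chains are nested to the left with the lowest name rightmost, so a new top projection enters
    at the far left by Ass. *)
Lemma pis_weaken k : forall m, sred (Comp (Pi (k + m)) (pis k m)) (pis (S k) m).
Proof.
  induction k as [|[|k] IH]; intros m.
  - eapply sred_rule; [constructor | apply rt_refl].
  - apply rt_refl.
  - eapply sred_rule; [constructor|]. apply sred_comp; [|apply rt_refl].
    replace (S (S k) + m) with (S k + S m) by lia. apply IH.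
Qed.

Lemma nsub_var P n s D f : nsub P n s D f -> forall a i,
  trans_tm D (Var a) (NVar (S i)) -> tred (Clo s (Var a)) (can n (f i)).
Proof.
  induction 1 as [k m f Hf | n s D f b H IH HP HC]; intros a i T.
  - destruct (trans_levels_var _ _ _ T) as (j & Hj & ? & ->).
    inversion Hj; subst. rewrite Hf by auto. simpl.
    (* Weakening raises the index and the depth by the same [k], so the level, and with it the name,
       stays the same. *)
    replace (k + m - S (k + j)) with (m - S j) by lia. apply pis_var. lia.
  - inversion T; subst.
    + eapply tred_rule; [constructor | apply rt_refl].
    + match goal with T' : trans_tm D (Var a) _ |- _ =>
        destruct (trans_var _ _ _ T') as (j & Hj & _) end.
      injection Hj as ->.
      eapply tred_rule; [constructor; congruence | apply IH; auto].
Qed.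

Lemma nsub_shift P n s f a D : nsub P n s (a :: D) f ->
  exists r, sred (Comp s (Pi a)) r /\ nsub P n r D (fun i => f (S i)).
Proof.
  intros H. remember (a :: D) as E eqn:EE.
  destruct H as [k m f Hf | n s E f b H HP HC].
  - destruct m as [|m]; simpl in EE; [discriminate|].
    injection EE as <- <-.
    (* For positive [k] the composite is by definition the longer chain; for [k = 0] the leading
       [Id] is removed by IdShift. *)
    exists (pis (S k) m). split.
    + destruct k; [|apply rt_refl].
      eapply sred_rule; [constructor | apply rt_refl].
    + replace (k + S m) with (S k + m) by lia. constructor.
      intros i Hi. rewrite Hf by lia. f_equal. lia.
  - injection EE as -> ->.
    exists s. split; auto. eapply sred_rule; [constructor | apply rt_refl].
Qed.

(** What the entries of a substitution must satisfy for it to be carried under a binder. *)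
Definition weakenable (P : db -> Prop) : Prop :=
  forall n t, P t -> closed n t ->
    P (ren S t) /\ tred (Clo (Pi n) (can n t)) (can (S n) (ren S t)).

Lemma nsub_weaken P n s D f : weakenable P -> nsub P n s D f ->
  exists r, sred (Comp (Pi n) s) r /\ nsub P (S n) r D (fun i => ren S (f i)).
Proof.
  intros W. induction 1 as [k m f Hf | n s D f a H (r & Hr & IH) HP HC].
  - exists (pis (S k) m). split; [apply pis_weaken|].
    apply (nsub_pis P (S k) m). intros i Hi. rewrite Hf; auto.
  - destruct (W n (f 0) HP HC) as (HP' & Hw).
    exists (Cons r (can (S n) (ren S (f 0))) a). split.
    + eapply sred_rule; [constructor|]. apply sred_cons; auto.
    + apply (nsub_cons P (S n) r D (fun i => ren S (f i))); auto using closed_shift.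
Qed.

(* The binder is first renamed to the level [n], which is fresh for [levels n]. *)
Lemma nsub_lam P n s D f a : weakenable P -> P (DVar 0) -> nsub P n s D f ->
  exists r, nsub P (S n) r (a :: D) (up f) /\
    forall M, tred (Clo s (Lam a M)) (Lam n (Clo r M)).
Proof.
  intros W P0 H. destruct (nsub_weaken _ _ _ _ _ W H) as (r & Hr & Hn).
  exists (Cons r (Var n) a). split.
  - apply nsub_cons_eq; auto; simpl; [lia|]. rewrite Nat.sub_0_r. reflexivity.
  - intros M.
    eapply rt_trans.
    { apply rt_step, S_CloR, S_rule_tm. apply (R_alpha1 a n). }
    eapply tred_rule; [constructor|]. apply tred_lam.
    eapply tred_rule; [constructor|]. apply tred_clo; [|apply rt_refl].
    (* After Map, ConsShift cancels the projection of the lifted substitution against that of the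
       renaming, leaving [Comp (Pi n) s], and ConsVar returns the binder [n]. *)
    unfold rename. eapply sred_rule; [constructor|]. apply sred_cons.
    + eapply sred_rule; [constructor|]. exact Hr.
    + eapply tred_rule; [constructor|]. apply rt_refl.
Qed.

Lemma weakenable_var : weakenable (fun t => exists i, t = DVar i).
Proof.
  intros n t (i & ->) C. simpl in *. split; [eauto|].
  eapply tred_rule; [constructor; lia | apply rt_refl].
Qed.

Lemma can_rename t : forall m n s f, closed m t ->
  nsub (fun t => exists i, t = DVar i) n s (levels m) f ->
  tred (Clo s (can m t)) (can n (subst f t)).
Proof.
  induction t; simpl; intros m n s f C H.
  - eapply nsub_var; [exact H|]. apply (trans_can (DVar i)), C.
  - destruct C. eapply tred_rule; [constructor|]. apply tred_app; eauto.
  - destruct (nsub_lam _ _ _ _ _ m weakenable_var (ex_intro _ 0 eq_refl) H)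
      as (r & Hr & Hred).
    eapply rt_trans; [apply Hred|]. apply tred_lam, IHt; auto.
Qed.

(** A bare projection is a normal substitution without explicit entries, so the case of variable
    entries already pushes it through any canonical term. *)
Lemma weakenable_all : weakenable (fun _ => True).
Proof.
  intros n t _ C. split; auto. rewrite ren_as_subst.
  apply can_rename; auto. apply nsub_pi. reflexivity.
Qed.

(** * Normalization of well-scoped terms *)

Notation nsubst := (nsub (fun _ => True)).

(** Only the outer context has to consist of levels; the inner context [D] is arbitrary, repetitions
    included, because its names are consumed by matching against the entries of [s]. *)
Lemma clo_normalize_mut :
  (forall D M U, trans_tm D M U -> forall n s f, nsubst n s D f ->
    tred (Clo s M) (can n (subst f (den U)))) /\
  (forall D q E v, trans_sb D q E v -> forall n s f, nsubst n s D f ->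
    exists r, sred (Comp s q) r /\ nsubst n r E (fun i => subst f (dens v i))).
Proof.
  apply trans_mutind.
  - intros G a n s f H. apply (nsub_var _ _ _ _ _ H a 0). auto with lp.
  - intros G a b i Hab T _ n s f H.
    apply (nsub_var _ _ _ _ _ H a i). auto with lp.
  - intros G M N U V _ IHM _ IHN n s f H. simpl.
    eapply tred_rule; [constructor|]. apply tred_app; auto.
  - intros G a M U _ IH n s f H. simpl.
    destruct (nsub_lam _ _ _ _ _ a weakenable_all I H) as (r & Hr & Hred).
    eapply rt_trans; [apply Hred|]. apply tred_lam, IH, Hr.
  - intros G D q M u U _ IHq _ IHM n s f H. simpl.
    destruct (IHq _ _ _ H) as (r & Hr & Hn).
    (* Clos merges the two substitutions, whose composite is normalized before it meets [M]. *)
    eapply tred_rule; [constructor|]. rewrite subst_subst.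
    eapply rt_trans; [apply tred_clo; [exact Hr | apply rt_refl]|]. auto.
  - intros G n s f H. exists s. split; auto.
    eapply sred_rule; [constructor | apply rt_refl].
  - intros G a n s f H. apply (nsub_shift _ _ _ _ _ _ H).
  - intros G D q N a u V _ IHq TN IHN n s f H.
    destruct (IHq _ _ _ H) as (r & Hr & Hn).
    exists (Cons r (can n (subst f (den V))) a). split.
    + eapply sred_rule; [constructor|]. apply sred_cons; auto.
    + eapply nsub_ext with (f := scons (subst f (den V)) (fun i => subst f (dens u i))).
      * apply nsub_cons_eq; auto.
        eapply closed_subst; [eapply nsub_closed, H | apply closed_den in TN; exact TN].
      * intros [|i]; reflexivity.
  - intros G D E q q' u v _ IHq _ IHq' n s f H.
    destruct (IHq _ _ _ H) as (r & Hr & Hn).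
    destruct (IHq' _ _ _ Hn) as (r' & Hr' & Hn').
    exists r'. split.
    + eapply sred_rule; [constructor|].
      eapply rt_trans; [apply sred_comp; [exact Hr | apply rt_refl] | exact Hr'].
    + eapply nsub_ext; [exact Hn'|]. intros i. simpl. symmetry. apply subst_subst.
Qed.

Definition clo_normalize := proj1 clo_normalize_mut.
Definition comp_normalize := proj2 clo_normalize_mut.

Lemma normalize_mut :
  (forall D M U, trans_tm D M U -> forall n, D = levels n ->
    tred M (can n (den U))) /\
  (forall D q E v, trans_sb D q E v -> forall n, D = levels n ->
    exists r, sred q r /\ nsubst n r E (dens v)).
Proof.
  assert (var_case : forall n a U, trans_tm (levels n) (Var a) U ->
            tred (Var a) (can n (den U))).
  { intros n a U T. destruct (trans_levels_var _ _ _ T) as (i & -> & ? & ->).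
    apply rt_refl. }
  apply trans_mutind.
  - intros G a n E. apply var_case. rewrite <- E. auto with lp.
  - intros G a b i Hab T _ n E. apply var_case. rewrite <- E. auto with lp.
  - intros G M N U V _ IHM _ IHN n E. apply tred_app; auto.
  - intros G a M U T _ n ->. simpl.
    (* The context [a :: levels n] is in general not a level context. Renaming the binder to [n]
       turns the body into a closure under a normal substitution, which denotes the identity. *)
    eapply tred_rule; [apply (R_alpha1 a n)|]. apply tred_lam.
    rewrite <- (subst_id (den U) (scons (DVar 0) (fun i => DVar (S i))))
      by (intros [|i]; reflexivity).
    eapply clo_normalize; [exact T|].
    apply nsub_cons_eq; auto using nsub_pi; simpl; [lia|].
    rewrite Nat.sub_0_r. reflexivity.
  - intros G D q M u U _ IHq TM _ n E.
    destruct (IHq n E) as (r & Hr & Hn).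
    eapply rt_trans; [apply tred_clo; [exact Hr | apply rt_refl]|].
    eapply clo_normalize; eauto.
  - intros G n ->. exists Id. split; [apply rt_refl | apply nsub_id; reflexivity].
  - intros G a [|n] E; simpl in E; [discriminate|]. injection E as -> ->.
    exists (Pi n). split; [apply rt_refl | apply nsub_pi; reflexivity].
  - intros G D q N a u V _ IHq TN IHN n E.
    destruct (IHq n E) as (r & Hr & Hn).
    exists (Cons r (can n (den V)) a). split; [apply sred_cons; auto|].
    apply nsub_cons_eq; auto.
    apply closed_den in TN. rewrite E, length_levels in TN. exact TN.
  - intros G D E q q' u v _ IHq T _ n EG.
    destruct (IHq n EG) as (r & Hr & Hn).
    (* The intermediate context may be arbitrary, so the second factor is absorbed by pushing the
       normalized first one through it. *)
    destruct (comp_normalize _ _ _ _ T _ _ _ Hn) as (r' & Hr' & Hn').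
    exists r'. split; auto.
    eapply rt_trans; [apply sred_comp; [exact Hr | apply rt_refl] | exact Hr'].
Qed.

Definition normalize := proj1 normalize_mut.

(** * Simulation of parallel reduction by canonical forms *)

Lemma can_par t u : par t u -> forall n, closed n t -> tred (can n t) (can n u).
Proof.
  induction 1; simpl; intros n C.
  - apply rt_refl.
  - destruct C. apply tred_app; auto.
  - apply tred_lam; auto.
  - destruct C as (Ct & Cu).
    eapply rt_trans; [apply tred_app; [apply tred_lam, IHpar1, Ct | apply IHpar2, Cu]|].
    eapply tred_rule; [constructor|].
    (* (Beta) has produced a closure under [Id] extended by one canonical entry; its body
       [can (S n) t'] translates to [nf_of_db t'], so [clo_normalize] yields the contracted term. *)
    rewrite <- (den_nf_of_db t') at 2.
    eapply clo_normalize; [apply trans_can, (closed_par _ _ H), Ct|].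
    apply nsub_cons_eq; auto using nsub_id. eapply closed_par; eauto.
Qed.

Lemma can_pars n t u :
  pars t u -> closed n t -> closed n u /\ tred (can n t) (can n u).
Proof.
  induction 1; intros C.
  - eauto using closed_par, can_par.
  - split; [assumption | apply rt_refl].
  - destruct (IHclos_refl_trans1 C) as (C' & ?).
    destruct (IHclos_refl_trans2 C') as (C'' & ?).
    split; auto. eapply rt_trans; eauto.
Qed.

(** * Canonical judgements and confluence *)

Lemma red_tm G M N : tred M N -> red (G, M) (G, N).
Proof. apply (rt_map step_tm step (pair G)), J_tm. Qed.

Lemma rename_context D : forall k M,
  exists N, red (D ++ levels k, M) (levels (length D + k), N).
Proof.
  induction D as [|a D IH] using rev_ind; intros k M.
  - exists M. apply rt_refl.
  - destruct (IH (S k) (Clo (lifts D (rename k a)) M)) as (N & HN).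
    exists N. rewrite <- app_assoc, length_app. simpl.
    replace (length D + 1 + k) with (length D + S k) by lia.
    eapply rt_trans; [apply rt_step, (J_alpha2 _ _ a k) | exact HN].
Qed.

Lemma red_canonical G M D N U : red (G, M) (D, N) -> trans_tm G M U ->
  exists t, pars (den U) t /\ closed (length G) t /\
    red (D, N) (levels (length G), can (length G) t).
Proof.
  intros R T.
  destruct (rename_context D 0 N) as (N' & HN).
  simpl in HN. rewrite app_nil_r, Nat.add_0_r in HN.
  destruct (red_den _ _ _ _ _ (rt_trans _ _ _ _ _ R HN) T) as (_ & V & TV & HV).
  (* This second use gives the length of [D], that is, the depth at which the canonical form is
     taken. *)
  destruct (red_den _ _ _ _ _ R T) as (El & _).
  rewrite El in *.
  exists (den V). split; [exact HV|]. split.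
  - apply closed_den in TV. rewrite length_levels in TV. exact TV.
  - eapply rt_trans; [exact HN|]. apply red_tm. eapply normalize; eauto.
Qed.

Theorem mainTheorem13 :
  forall (G1 G2 D1 D2 : ctx) (M1 M2 N1 N2 : tm),
    alpha_equiv (G1, M1) (G2, M2) ->
    red (G1, M1) (D1, N1) ->
    red (G2, M2) (D2, N2) ->
    exists (S1 S2 : ctx) (L1 L2 : tm),
      red (D1, N1) (S1, L1) /\
      red (D2, N2) (S2, L2) /\
      alpha_equiv (S1, L1) (S2, L2).
Proof.
  intros G1 G2 D1 D2 M1 M2 N1 N2 (K & T1 & T2) R1 R2.
  destruct K as [k U].
  assert (E1 : length G1 = k /\ trans_tm G1 M1 U) by (inversion T1; auto).
  assert (E2 : length G2 = k /\ trans_tm G2 M2 U) by (inversion T2; auto).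
  destruct E1 as (E1 & H1), E2 as (E2 & H2).
  destruct (red_canonical _ _ _ _ _ R1 H1) as (t1 & P1 & C1 & Q1).
  destruct (red_canonical _ _ _ _ _ R2 H2) as (t2 & P2 & C2 & Q2).
  rewrite E1 in C1, Q1. rewrite E2 in C2, Q2.
  (* Both [t1] and [t2] are reducts of [den U], since the two initial judgements share the
     translation [U]. *)
  destruct (pars_confluent _ _ _ P1 P2) as (w & W1 & W2).
  destruct (can_pars _ _ _ W1 C1) as (Cw & X1).
  destruct (can_pars _ _ _ W2 C2) as (_ & X2).
  (* Both sides reach literally the same canonical judgement, so the final equivalence only needs
     that it translates. *)
  exists (levels k), (levels k), (can k w), (can k w). repeat split.
  - eapply rt_trans; [exact Q1 | apply red_tm, X1].
  - eapply rt_trans; [exact Q2 | apply red_tm, X2].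
  - eexists; split; constructor; apply trans_can, Cw.
Qed.
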